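(* Let $(M=G/H,ds^2)$ be a connected pseudo-Riemannian $G$-geodesic orbit nilmanifold of metric index three, where $G=N\rtimes H$ with $N$ nilpotent. Let $\langle\cdot,\cdot\rangle$ denote the inner product on $\mathfrak n=\mathrm{Lie}(N)$ induced by $ds^2$, and let $\mathfrak d=[\mathfrak n,\mathfrak n]$. If the restriction of $\langle\cdot,\cdot\rangle$ to $\mathfrak d$ is nondegenerate, then $N$ is abelian, two-step nilpotent or four-step nilpotent.
   Context: Setting: $N$ is a connected nilpotent Lie group with (real, finite-dimensional) Lie algebra $\mathfrak n$, equipped with a left-invariant pseudo-Riemannian metric $ds^2$ given by a nondegenerate symmetric bilinear form (''inner product'') $\langle\cdot,\cdot\rangle$ on $\mathfrak n$; $H$ is a connected Lie group of automorphisms of $N$ preserving $ds^2$; $G=N\rtimes H$ acts on $M=G/H\cong N$ by isometries. Thus $\mathfrak g=\mathfrak h\oplus\mathfrak n$ is a reductive decomposition, and $\mathfrak h=\mathrm{Lie}(H)$ is identified with a Lie algebra of derivations of $\mathfrak n$ that are skew-adjoint with respect to $\langle\cdot,\cdot\rangle$; for $A\in\mathfrak h$, $X\in\mathfrak n$ write $AX=[A,X]$. $M$ is $G$-geodesic orbit (GO) if every geodesic is an orbit of a one-parameter subgroup of $G$. By the Geodesic Lemma this is equivalent to: for every $T\in\mathfrak n$ there exist $A\in\mathfrak h$ and $k\in\mathbb R$ such that $\langle [T,T']+AT',\,T\rangle=k\langle T,T'\rangle$ for all $T'\in\mathfrak n$. The index of a symmetric bilinear form is its number of negative squares; metric index three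 means signature $(n-3,3)$, $n=\dim N$. *)

(* Defs.v *)
From mathcomp Require Import all_boot all_order all_algebra.
From mathcomp Require Import sesquilinear reals.

Set Implicit Arguments.
Unset Strict Implicit.
Unset Printing Implicit Defensive.

Import Order.TTheory GRing.Theory Num.Theory.
Local Open Scope ring_scope.

Section LieAlgebra.
Variables (R : realType) (n : vectType R) (br : {bilinear n -> n -> n}).

Definition is_lie_bracket : Prop :=
  (forall x, br x x = 0) /\
  (forall x y z, br x (br y z) + br y (br z x) + br z (br x y) = 0).

(* The span of all [x, y] with x in U and y in W: by bilinearity, brackets of
   basis vectors suffice (lie_prod_subvP below). *)
Definition lie_prod (U W : {vspace n}) : {vspace n} :=
  <<[seq br x y | x <- vbasis U, y <- vbasis W]>>%VS.

Definition derived_algebra : {vspace n} := lie_prod fullv fullv.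

(* Indexed from zero: the first terms are n, [n, n], [n, [n, n]]. *)
Definition lower_central (k : nat) : {vspace n} := iter k (lie_prod fullv) fullv.

Definition is_nilpotent : Prop := exists k, lower_central k = 0%VS.

(* The nilpotency class is exactly k. *)
Definition step_nilpotent (k : nat) : Prop :=
  lower_central k = 0%VS /\ forall j, (j < k)%N -> lower_central j <> 0%VS.

Definition is_abelian : Prop := forall x y, br x y = 0.

Definition is_derivation (A : 'End(n)) : Prop :=
  forall x y, A (br x y) = br (A x) y + br x (A y).

Lemma lie_prod_subvP (U W X : {vspace n}) :
  reflect (forall x y, x \in U -> y \in W -> br x y \in X)
          (lie_prod U W <= X)%VS.
Proof.
apply: (iffP span_subvP) => [sX x y Ux Wy|sX _ /allpairsP[[x y] [/= xU yW ->]]].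
  rewrite (coord_vbasis Ux) (coord_vbasis Wy).
  rewrite linear_sumlz; apply: memv_suml => i _ /=.
  rewrite linear_sumr; apply: memv_suml => j _ /=.
  rewrite linearZl_LR linearZr_LR /=; do 2!apply: memvZ.
  by apply/sX/allpairs_f; apply: mem_nth; rewrite size_tuple.
by apply: sX; apply: vbasis_mem.
Qed.

End LieAlgebra.

Section Metric.
Variables (R : realType) (n : vectType R) (g : {symmetric n}).

(* Number of negative squares in a diagonalization of g; it does not depend on
   the orthogonal basis e, by Sylvester's law of inertia. *)
Definition has_index (k : nat) : Prop :=
  exists e : (\dim {:n}).-tuple n,
    [/\ basis_of fullv e,
        forall i j : 'I_(\dim {:n}), i != j -> g (tnth e i) (tnth e j) = 0
      & #|[set i | g (tnth e i) (tnth e i) < 0]| = k].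

Definition nondegenerate_on (U : {vspace n}) : Prop :=
  forall x, x \in U -> (forall y, y \in U -> g x y = 0) -> x = 0.

Definition skew_adjoint (A : 'End(n)) : Prop :=
  forall x y, g (A x) y = - g x (A y).

End Metric.

Section GeodesicOrbit.
Variables (R : realType) (n : vectType R).
Variables (br : {bilinear n -> n -> n}) (g : {symmetric n}).
Variable h : {vspace 'End(n)}.

(* h is a Lie algebra of skew-adjoint derivations of n: the Lie algebra of a
   connected group H of isometric automorphisms of N. *)
Definition is_isotropy_algebra : Prop :=
  [/\ forall A B, A \in h -> B \in h -> (A \o B)%VF - (B \o A)%VF \in h,
      forall A, A \in h -> is_derivation br A
    & forall A, A \in h -> skew_adjoint g A].

(* The geodesic orbit condition for M = (N x| H) / H, in the form provided by
   the Geodesic Lemma: after an affine or exponential reparametrization (k = 0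
   or k <> 0), the geodesic with initial velocity T is the orbit of the
   one-parameter group generated by T + A.  In the Lie algebra of N x| H one
   has [T + A, T'] = [T, T'] + A T' for T' in n. *)
Definition geodesic_orbit : Prop :=
  forall T : n, exists2 A : 'End(n), A \in h &
    exists k : R, forall T' : n, g (br T T' + A T') T = k * g T T'.

End GeodesicOrbit.

(* Main.v *)
Require Import Defs.
From mathcomp Require Import all_boot all_order all_algebra.
From mathcomp Require Import sesquilinear reals.
From mathcomp Require Import boolp.
From mathcomp Require Import ring lra.

Set Implicit Arguments.
Unset Strict Implicit.
Unset Printing Implicit Defensive.

Import Order.TTheory GRing.Theory Num.Theory.
Local Open Scope ring_scope.

(* Let d = [n, n] and v = d^perp, so that n = v + d.  The geodesic condition at
   T = X + Z with X in v and Z in d gives <[X, Z], Z> = 0; since v generates n,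
   every ad x is skew on d.  As the total index is three, either d or v contains
   no pair of orthogonal negative vectors.

   If d contains no such pair and [n, d] <> 0, take a central e <> 0 in the last
   nonzero term of the lower central series.  It is isotropic, and every ad x,
   being skew and nilpotent on the Euclidean space e^perp / e, acts trivially
   there; so n is at most four-step.  It is not three-step, because then [n, d]
   would be totally isotropic, hence a line, and skewness would make it zero.

   If v contains no such pair, replace Z by s Z and let s vary: for non-null X
   some A in h satisfies A X = 0 and A Z = [X, Z].  Take X negative, or any X <> 0
   if v is Euclidean.  Then A is a skew operator on the Euclidean space
   v /\ X^perp, hence semisimple.  If w = [X, Z] is central, then A w = 0, so A
   acts on the form <Z, [., .]> on v as a square-zero operation, and
   semisimplicity makes <w, [v, v]> vanish; thus w = 0.  Such X span v, so d is
   its own second centre, and by nilpotency d is central. *)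

(** * Orthogonal complements and negative vectors of a symmetric form *)

Section SymmetricForm.
Variables (R : realType) (n : vectType R) (g : {symmetric n}).
Implicit Types (x y z u w : n) (U : {vspace n}).

Lemma formC x y : g x y = g y x.
Proof. by rewrite hermC /= expr0 mul1r. Qed.

Lemma formDl x y z : g (x + y) z = g x z + g y z. Proof. exact: linearDl. Qed.
Lemma formNl x z : g (- x) z = - g x z. Proof. exact: linearNl. Qed.
Lemma formZl a x z : g (a *: x) z = a * g x z. Proof. exact: linearZl_LR. Qed.
Lemma formDr x y z : g z (x + y) = g z x + g z y. Proof. exact: linearDr. Qed.
Lemma formNr x z : g z (- x) = - g z x. Proof. exact: linearNr. Qed.
Lemma formZr a x z : g z (a *: x) = a * g z x. Proof. exact: linearZr_LR. Qed.

Definition formE := (formDl, formNl, formZl, formDr, formNr, formZr).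

Lemma form0l x : g 0 x = 0. Proof. exact: linear0l. Qed.
Lemma form0r x : g x 0 = 0. Proof. exact: linear0r. Qed.

(** Equivalently, [U] contains a negative definite plane. *)
Definition has_negative_pair U :=
  exists u w, [/\ u \in U, w \in U, g u u < 0, g w w < 0 & g u w = 0].

Definition positive_definite_on U := {in U, forall x, x != 0 -> 0 < g x x}.

(** Orthogonality to each vector of a basis of [U] is one linear condition and lowers the dimension
    by at most one. *)
Lemma leq_dim_orthov U : (\dim {:n} <= \dim (orthov g U) + \dim U)%N.
Proof.
rewrite /orthov; move: (\dim U) (val (vbasis U)) => m b.
elim: m => [|m IHm]; first by rewrite big_ord0 addn0.
rewrite big_ord_recr /=; apply: leq_trans IHm _.
set W := (\bigcap_(i < m) _)%VS.
have := leq_dim_orthov1 g b`_m W; rewrite orthov1E.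
by rewrite addnS -addSn leq_add2r; case: (\dim W).
Qed.

Lemma orthov_decomp U x : nondegenerate_on g U ->
  exists y z, [/\ y \in orthov g U, z \in U & x = y + z].
Proof.
move=> ndU; have /eqP cap0 : (orthov g U :&: U == 0)%VS.
  rewrite -subv0; apply/subvP => y; rewrite memv_cap memv0.
  by case/andP => /mem_orthovP oy Uy; apply/eqP/ndU.
have /eqP sumf : (orthov g U + U == fullv)%VS.
  by rewrite eqEdim subvf dimv_disjoint_sum // leq_dim_orthov.
have: x \in (orthov g U + U)%VS by rewrite sumf memvf.
by case/memv_addP => y oy [z Uz ->]; exists y, z.
Qed.

Lemma nondegenerate_on_orthov U :
  nondegenerate_on g fullv -> nondegenerate_on g U ->
  nondegenerate_on g (orthov g U).
Proof.
move=> ndf ndU x /mem_orthovP ox xP; apply: ndf (memvf _) _ => t _.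
by have [y [z [oy Uz ->]]] := orthov_decomp t ndU; rewrite formDr xP // ox // addr0.
Qed.

Lemma neg_combination x y : g x x = 0 -> g x y != 0 ->
  exists t, g (y + t *: x) (y + t *: x) < 0.
Proof.
(* As [x] is isotropic, the square of [y + t *: x] is affine in [t] with slope [2 * g x y]; this [t]
   gives it the value -1. *)
move=> xx xy; exists (- (g y y + 1) / (2 * g x y)).
set t := _ / _; have -> : g (y + t *: x) (y + t *: x) = g y y + 2 * g x y * t.
  by rewrite !formE xx (formC y x); ring.
suff -> : 2 * g x y * t = - (g y y + 1) by lra.
by rewrite /t; field.
Qed.

Lemma semidefinite_isotropic U x y : {in U, forall u, 0 <= g u u} ->
  x \in U -> y \in U -> g x x = 0 -> g x y = 0.
Proof.
move=> U0 Ux Uy xx; apply/eqP/contraT => xy.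
have [t] := neg_combination xx xy.
by rewrite ltNge U0 // memvD // memvZ.
Qed.

(* Counts dimensions: some nontrivial combination of the x i has vanishing
   coordinates along the negative vectors of an orthogonal basis. *)
Lemma index_bound k m (x : 'I_m -> n) : has_index g k ->
  (forall i, g (x i) (x i) < 0) ->
  (forall i j, i != j -> g (x i) (x j) = 0) -> (m <= k)%N.
Proof.
case=> e [be oe <-] xneg xorth; rewrite leqNgt; apply/negP => km.
set N := [set i | _] in km.
pose M := \matrix_(a < m, b < #|N|) coord e (enum_val b) (x a).
have /rowV0Pn [c cM c0] : kermx M != 0.
  by rewrite -mxrank_eq0 mxrank_ker subn_eq0 -ltnNge (leq_ltn_trans (rank_leq_col _)).
pose y := \sum_a c 0 a *: x a.
have yN i : i \in N -> coord e i y = 0.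
  move=> iN; rewrite linear_sum /=.
  have := sub_kermxP cM => /matrixP /(_ 0 (enum_rank_in iN i)); rewrite !mxE => cM0.
  by rewrite -[RHS]cM0; apply: eq_bigr => a _; rewrite linearZ mxE enum_rankK_in.
have sumD (I : finType) (f : I -> R) (v : I -> n) :
    (forall i j, i != j -> g (v i) (v j) = 0) ->
    g (\sum_i f i *: v i) (\sum_i f i *: v i) = \sum_i f i ^+ 2 * g (v i) (v i).
  move=> ov; rewrite linear_sumlz; apply: eq_bigr => i _ /=.
  rewrite linear_sumr (bigD1 i) //= big1 ?addr0 => [|j ji].
    by rewrite formZl formZr mulrA expr2.
  by rewrite formZl formZr ov ?mulr0 // eq_sym.
(* Expanded in the [x a], the square of [y] is negative; expanded in the basis [e], it keeps only
   nonnegative terms. *)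
have : g y y < 0.
  rewrite sumD //; have [a ca] : exists a, c 0 a != 0 by apply/rV0Pn.
  rewrite (bigD1 a) //= ltr_wnDr //.
    by apply: sumr_le0 => j _; rewrite mulr_ge0_le0 ?sqr_ge0 // ltW.
  by rewrite pmulr_rlt0 // lt0r sqr_ge0 sqrf_eq0 ca.
rewrite (coord_basis be (memvf y)).
under eq_bigr do rewrite -tnth_nth.
rewrite sumD //; apply/negP; rewrite -leNgt sumr_ge0 // => i _.
have [iN|] := boolP (i \in N); first by rewrite yN // expr0n mul0r.
by rewrite inE -leNgt => ?; rewrite mulr_ge0 // sqr_ge0.
Qed.

End SymmetricForm.

(** * Skew operators on a Euclidean subspace *)

Section SkewOperators.
Variables (R : realType) (n : vectType R) (g : {symmetric n}).
Implicit Types (x y z u w : n) (U : {vspace n}) (s : seq n) (a b : n -> R).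

(* An orthonormal basis of U, of which only the Parseval expansion is needed. *)
Lemma parseval_frame U : positive_definite_on g U ->
  exists2 s, {subset s <= U} & {in U, forall y, y = \sum_(x <- s) g y x *: x}.
Proof.
have [m] := ubnP (\dim U); elim: m U => // m IHm U dimU posU.
have [->|U0] := eqVneq U 0%VS.
  by exists [::] => // y; rewrite memv0 big_nil => /eqP.
pose x0 := vpick U; have Ux0 : x0 \in U by apply: memv_pick.
have g0 : 0 < g x0 x0 by apply: posU; rewrite ?vpick0.
have [x Ux gx] : exists2 x, x \in U & g x x = 1.
  exists ((Num.sqrt (g x0 x0))^-1 *: x0); first exact: memvZ.
  by rewrite !formE mulrA -expr2 exprVn sqr_sqrtr ?ltW // mulVf // gt_eqF.
pose W := (U :&: orthov g <[x]>)%VS.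
have WP y : y \in W = (y \in U) && (g y x == 0) by rewrite memv_cap mem_orthov1.
have [||s sW sP] := IHm W.
- rewrite -ltnS; apply: leq_trans dimU; rewrite ltnS.
  have /dimvS := capvSl U (orthov g <[x]>); rewrite leq_eqVlt => /orP[|//].
  rewrite -/W => /eqP eqd; have : x \in W.
    by have /eqP -> : (W == U)%VS by rewrite eqEdim capvSl eqd /=.
  by rewrite WP gx oner_eq0 andbF.
- by move=> y; rewrite WP => /andP[/posU].
exists (x :: s) => [y|y Uy].
  by rewrite inE => /predU1P[->//|/sW]; rewrite WP => /andP[].
have Wy : y - g y x *: x \in W.
  by rewrite WP memvB ?memvZ //= !formE gx mulr1 subrr.
rewrite big_cons -{1}(subrK (g y x *: x) y) addrC; congr (_ + _).
rewrite {1}(sP _ Wy); apply: eq_big_seq => z /sW.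
by rewrite WP !formE => /andP[_ /eqP]; rewrite formC => ->; rewrite mulr0 subr0.
Qed.

Lemma psum_seq_eq0 s (F : n -> R) : (forall x, 0 <= F x) ->
  \sum_(x <- s) F x = 0 -> {in s, forall x, F x = 0}.
Proof.
move=> F0 /eqP; rewrite psumr_eq0 => [/allP sF x /sF|x _]; last exact: F0.
by rewrite implyTb => /eqP.
Qed.

Section Frame.
Variables (U : {vspace n}) (s : seq n) (A : 'End(n)).
Hypotheses (sU : {subset s <= U}).
Hypothesis sP : {in U, forall y, y = \sum_(x <- s) g y x *: x}.
Hypotheses (AU : {in U, forall x, A x \in U}) (Askew : skew_adjoint g A).

Lemma scalar_frame a y : scalar a -> y \in U ->
  a y = \sum_(x <- s) g y x * a x.
Proof.
move=> al Uy; have a0 : a 0 = 0.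
  by have := al (-1) 0 0; rewrite scaler0 addr0 mulN1r addNr.
rewrite {1}(sP Uy); elim: s => [|x r IHr]; first by rewrite !big_nil.
by rewrite !big_cons al IHr.
Qed.

(** Expanding [A x] in the frame turns both sides into double sums over the skew matrix
    [g (A x) y]. *)
Lemma frame_skew_sum a b : scalar a -> scalar b ->
  \sum_(x <- s) a (A x) * b x = - \sum_(x <- s) a x * b (A x).
Proof.
move=> al bl; pose F x y := g (A x) y * a y * b x.
have -> : \sum_(x <- s) a (A x) * b x = \sum_(x <- s) \sum_(y <- s) F x y.
  apply: eq_big_seq => x /sU Ux; rewrite (scalar_frame al (AU Ux)).
  by rewrite mulr_suml.
rewrite exchange_big /= -sumrN; apply: eq_big_seq => y /sU Uy.
rewrite (scalar_frame bl (AU Uy)) mulr_sumr -sumrN; apply: eq_bigr => x _.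
by rewrite /F Askew formC; ring.
Qed.

(** Semisimplicity on linear forms: the squared norm of [a \o A] is minus the pairing of [a] with
    [a \o A \o A], hence zero. *)
Lemma skew_scalar_ker2 a : scalar a ->
  {in U, forall y, a (A (A y)) = 0} -> {in U, forall y, a (A y) = 0}.
Proof.
move=> al a2; have aAl : scalar (a \o A) by move=> c x y /=; rewrite linearP al.
have := frame_skew_sum al aAl; rewrite [X in _ = - X]big_seq.
rewrite [X in _ = - X]big1 ?oppr0 => [sq0 y Uy|x /sU Ux]; last first.
  by rewrite /= a2 // mulr0.
rewrite -[LHS]/((a \o A) y) (scalar_frame aAl Uy) big_seq big1 // => x sx.
have /(_ x sx)/eqP : {in s, forall x, a (A x) * (a \o A) x = 0}.
  by apply: psum_seq_eq0 sq0 => z; rewrite /= -expr2 sqr_ge0.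
by rewrite /= mulf_eq0 orbb => /eqP ->; rewrite mulr0.
Qed.

(** Up to sign, the infinitesimal action of [A] on bilinear forms. *)
Let act (f : n -> n -> R) x y := f (A x) y + f x (A y).

(** Semisimplicity on bilinear forms: [act] is skew for the Hilbert-Schmidt product [S], so
    [S (act f) (act f)] is minus the pairing of [f] with [act (act f)]. *)
Lemma skew_biscalar_ker2 (f : n -> n -> R) :
  (forall x, scalar (f x)) -> (forall y, scalar (f ^~ y)) ->
  {in U &, forall x y, act (act f) x y = 0} ->
  {in U &, forall x y, act f x y = 0}.
Proof.
move=> fr fl f2.
have hr x : scalar (act f x) by move=> c y z; rewrite /act !(linearP, fr); ring.
have hl y : scalar ((act f)^~ y).
  by move=> c x z; rewrite /act !linearP [f (_ + _) y]fl [f (_ + _) (A y)]fl; ring.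
pose S (p q : n -> n -> R) := \sum_(x <- s) \sum_(y <- s) p x y * q x y.
have S0 : S (act f) (act f) = 0.
  have -> : S (act f) (act f) = S (fun x y => f (A x) y) (act f)
                               + S (fun x y => f x (A y)) (act f).
    rewrite /S -big_split; apply: eq_bigr => x _; rewrite -big_split /=.
    by apply: eq_bigr => y _; rewrite -mulrDl.
  have -> : S (fun x y => f (A x) y) (act f) = - S f (fun x y => act f (A x) y).
    rewrite /S exchange_big [in RHS]exchange_big /= -sumrN.
    by apply: eq_bigr => y _; rewrite (frame_skew_sum (fl y) (hl y)).
  have -> : S (fun x y => f x (A y)) (act f) = - S f (fun x y => act f x (A y)).
    rewrite /S /= -sumrN.
    by apply: eq_bigr => x _; rewrite (frame_skew_sum (fr x) (hr x)).
  rewrite -opprD /S -big_split big_seq big1 ?oppr0 // => x /sU Ux.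
  rewrite -big_split big_seq big1 //= => y /sU Uy.
  by rewrite -mulrDr -[X in _ * X]/(act (act f) x y) f2 // mulr0.
have h0 x y : x \in s -> y \in s -> act f x y = 0.
  have sq0 z t : 0 <= act f z t * act f z t by rewrite -expr2 sqr_ge0.
  move=> sx sy; have Sx := psum_seq_eq0 (fun z => sumr_ge0 _ (fun t _ => sq0 z t)) S0 sx.
  by have /eqP := psum_seq_eq0 (sq0 x) Sx sy; rewrite mulf_eq0 orbb => /eqP.
move=> x y Ux Uy; rewrite (scalar_frame (hr x) Uy) big_seq big1 // => z sz.
rewrite (scalar_frame (hl z) Ux : act f x z = _) big_seq big1 ?mulr0 //.
by move=> t st; rewrite h0 ?mulr0.
Qed.

End Frame.
End SkewOperators.

(** * Lower central series and generation of nilpotent Lie algebras *)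

Section NilpotentLieAlgebra.
Variables (R : realType) (n : vectType R) (br : {bilinear n -> n -> n}).
Hypothesis hbr : is_lie_bracket br.
Implicit Types (x y z : n) (U W : {vspace n}) (P : n -> Prop).

Lemma brDl x y z : br (x + y) z = br x z + br y z. Proof. exact: linearDl. Qed.
Lemma brNl x z : br (- x) z = - br x z. Proof. exact: linearNl. Qed.
Lemma brZl a x z : br (a *: x) z = a *: br x z. Proof. exact: linearZl_LR. Qed.
Lemma brDr x y z : br z (x + y) = br z x + br z y. Proof. exact: linearDr. Qed.
Lemma brNr x z : br z (- x) = - br z x. Proof. exact: linearNr. Qed.
Lemma brZr a x z : br z (a *: x) = a *: br z x. Proof. exact: linearZr_LR. Qed.

Definition brE := (brDl, brNl, brZl, brDr, brNr, brZr).

Lemma br0l x : br 0 x = 0. Proof. exact: linear0l. Qed.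
Lemma br0r x : br x 0 = 0. Proof. exact: linear0r. Qed.

Lemma brxx x : br x x = 0. Proof. by case: hbr. Qed.

Lemma brC x y : br x y = - br y x.
Proof.
apply/eqP; rewrite -addr_eq0; apply/eqP.
by have := brxx (x + y); rewrite !brE !brxx add0r addr0.
Qed.

Lemma br_jacobi x y z : br (br x y) z = br x (br y z) - br y (br x z).
Proof.
have [_ /(_ x y z)] := hbr.
by rewrite (brC z x) brNr (brC z (br x y)) => /eqP; rewrite subr_eq0 => /eqP <-.
Qed.

Lemma lie_prod_ind U W P :
  (forall x y, x \in U -> y \in W -> P (br x y)) ->
  P 0 -> (forall c x y, P x -> P y -> P (c *: x + y)) ->
  {in lie_prod br U W, forall z, P z}.
Proof.
move=> Pbr P0 Plin z; rewrite /lie_prod.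
set s := [seq _ | _ <- _, _ <- _].
rewrite -[s]in_tupleE => /coord_span ->.
apply: (big_ind P) => // [x y Px Py|i _].
  by rewrite -[x]scale1r; apply: Plin.
rewrite -[_ *: _]addr0; apply: Plin => //.
have /allpairsP[[x y] [/= xU yW ->]] := mem_nth 0 (ltn_ord i).
by apply: Pbr; apply: vbasis_mem.
Qed.

Lemma br_lie_prod U W x y : x \in U -> y \in W -> br x y \in lie_prod br U W.
Proof. by have /lie_prod_subvP := subvv (lie_prod br U W); apply. Qed.

Lemma br_derived x y : br x y \in derived_algebra br.
Proof. by rewrite br_lie_prod ?memvf. Qed.

Lemma br_lower_central k x y :
  y \in lower_central br k -> br x y \in lower_central br k.+1.
Proof. by move=> yk; rewrite /lower_central iterS br_lie_prod ?memvf. Qed.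

Lemma lower_central_subS k : (lower_central br k.+1 <= lower_central br k)%VS.
Proof.
elim: k => [|k IHk]; first exact: subvf.
apply/lie_prod_subvP => x y _ yk; apply: br_lower_central.
exact: (subvP IHk).
Qed.

Lemma lower_central_sub j k : (j <= k)%N ->
  (lower_central br k <= lower_central br j)%VS.
Proof.
move=> /subnK <-; elim: (k - j)%N => // i IHi.
exact: subv_trans (lower_central_subS _) IHi.
Qed.

Lemma step_nilpotentP k : lower_central br k.+1 = 0%VS ->
  lower_central br k <> 0%VS -> step_nilpotent br k.+1.
Proof.
move=> lc0 lcN; split=> // j; rewrite ltnS => jk lcj; apply: lcN.
by apply/eqP; rewrite -subv0 -lcj lower_central_sub.
Qed.

(** By induction on [k], every [x] agrees with an element of the subalgebra [P] modulo
    [lower_central br k.+1], which is eventually zero. *)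
Lemma nilpotent_generation P : is_nilpotent br ->
  (forall c x y, P x -> P y -> P (c *: x + y)) ->
  (forall x y, P x -> P y -> P (br x y)) ->
  (forall x, exists y z, [/\ P y, z \in derived_algebra br & x = y + z]) ->
  forall x, P x.
Proof.
move=> [k0 lck0] Plin Pbr Pgen.
have P0 : P 0.
  by have [y [_ [Py _ _]]] := Pgen 0; have := Plin (-1) _ _ Py Py; rewrite scaleN1r addNr.
suff approx k x : exists y z, [/\ P y, z \in lower_central br k.+1 & x = y + z].
  move=> x; have [y [z [Py]]] := approx k0 x.
  move=> /(subvP (lower_central_subS _)); rewrite lck0 memv0 => /eqP -> ->.
  by rewrite addr0.
elim: k x => [|k IHk] x; first exact: Pgen.
have [y [z [Py zd ->]]] := Pgen x.
suff [y' [z' [Py' z'k ->]]] :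
    exists y' z', [/\ P y', z' \in lower_central br k.+2 & z = y' + z'].
  exists (y + y'), z'; split; rewrite ?addrA //.
  by rewrite -[y]scale1r; apply: Plin.
move: z zd; apply: lie_prod_ind.
- move=> a b _ _; have [ya [ca [Pya cak ->]]] := IHk a.
  have [yb [cb [Pyb cbk ->]]] := IHk b.
  (* The bracket of the two approximations; each error term contains [ca] or [cb] and so lies one
     level deeper. *)
  exists (br ya yb), (br (ya + ca) cb - br yb ca); split; first exact: Pbr.
    by rewrite memvB ?br_lower_central.
  by rewrite -(brC ca yb) [LHS]brDr [br _ yb]brDl -addrA [br ca yb + _]addrC.
- by exists 0, 0; rewrite mem0v addr0.
move=> c a b [ya [za [Pya zak ->]]] [yb [zb [Pyb zbk ->]]].
exists (c *: ya + yb), (c *: za + zb); split; first exact: Plin.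
  by rewrite memvD ?memvZ.
by rewrite scalerDr addrACA.
Qed.

End NilpotentLieAlgebra.

(** * Isotropic vectors in a nondegenerate subspace of index at most one *)

Section LorentzianSubspace.
Variables (R : realType) (n : vectType R) (g : {symmetric n}) (U : {vspace n}).
Hypotheses (ndU : nondegenerate_on g U) (npU : ~ has_negative_pair g U).
Implicit Types (x y z e f : n).

Lemma nondegenerate_pairing e : e \in U -> e != 0 -> exists2 f, f \in U & g e f != 0.
Proof.
move=> Ue e0; apply/mem_orthovPn; apply: contraNN e0 => /mem_orthovP oe.
by apply/eqP/ndU.
Qed.

(** If [y] were negative, its orthogonal in [U] would contain the isotropic [e] and a vector [f']
    pairing with it, hence a negative vector, which forms a negative pair with [y]. *)
Lemma isotropic_orth_nonneg e y : e \in U -> e != 0 -> g e e = 0 ->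
  y \in U -> g e y = 0 -> 0 <= g y y.
Proof.
move=> Ue e0 ee Uy ey; rewrite leNgt; apply/negP => yy; apply: npU.
have [f Uf ef] := nondegenerate_pairing Ue e0.
pose f' := f - (g f y / g y y) *: y.
have Uf' : f' \in U by rewrite memvB ?memvZ.
have yy0 : g y y != 0 by rewrite lt_eqF.
have ef' : g e f' != 0 by rewrite /f' !formE ey mulr0 subr0.
have f'y : g f' y = 0 by rewrite /f' !formE; field.
have [t tneg] := neg_combination ee ef'; exists (f' + t *: e), y.
split=> //; first by rewrite memvD ?memvZ.
by rewrite formDl formZl f'y ey mulr0 addr0.
Qed.

(** The orthogonal of [e] in [U] is semidefinite, so its isotropic vectors lie in its radical, which
    is the line of [e]. *)
Lemma isotropic_orth_line e y : e \in U -> e != 0 -> g e e = 0 ->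
  y \in U -> g e y = 0 -> g y y = 0 -> exists c, y = c *: e.
Proof.
move=> Ue e0 ee Uy ey yy; have [f Uf ef] := nondegenerate_pairing Ue e0.
exists (g y f / g e f); apply/eqP; rewrite -subr_eq0; apply/negPn/negP => y0.
have [|w Uw yw] := nondegenerate_pairing _ y0; first by rewrite memvB ?memvZ.
(* The projection of [w] along [f] onto the orthogonal of [e]. By the choice of coefficients,
   [g y w'] equals the pairing of [w] with [y] minus its multiple of [e]. *)
pose w' := w - (g e w / g e f) *: f.
have Uw' : w' \in U by rewrite memvB ?memvZ.
have yw' : g y w' != 0.
  by apply: contraNN yw => /eqP yw'; apply/eqP; rewrite -yw' /w' !formE; field.
have [t] := neg_combination yy yw'; rewrite ltNge (isotropic_orth_nonneg Ue) //.
  by rewrite memvD ?memvZ.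
by rewrite /w' !formE ey; field.
Qed.

End LorentzianSubspace.

(** * Nilpotent Lie algebras whose adjoint operators are skew on [d] *)

Section SkewBracket.
Variables (R : realType) (n : vectType R).
Variables (br : {bilinear n -> n -> n}) (g : {symmetric n}).
Hypothesis hnil : is_nilpotent br.
Let d := derived_algebra br.
Let lc := lower_central br.
Hypothesis skew : forall x, {in d &, forall z w, g (br x z) w = - g z (br x w)}.
Implicit Types (x y z e : n).

Lemma lc2_derived : {subset lc 2 <= d}.
Proof. exact/subvP/(lower_central_subS br 1). Qed.

(** Skewness moves [ad x] from [z = [x, y]] onto [e], where it vanishes. *)
Lemma central_orth e z : e \in d -> (forall x, br x e = 0) ->
  z \in lc 2 -> g e z = 0.
Proof.
move=> de ce; move: z; apply: lie_prod_ind => [x y _ dy||c x y gx gy].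
- by rewrite formC skew // ce form0r oppr0.
- by rewrite form0r.
- by rewrite !formE gx gy mulr0 addr0.
Qed.

Lemma lower_central_top : lc 2 <> 0%VS ->
  exists2 e, e != 0 & e \in lc 2 /\ forall x, br x e = 0.
Proof.
move=> lc2; have hnilb : exists k, lc k == 0%VS by case: hnil => k /eqP; exists k.
case: (ex_minnP hnilb) => -[|k] /eqP lck kmin.
  by case: lc2; apply/eqP; rewrite -subv0 -lck lower_central_sub.
have lck0 : lc k != 0%VS by apply/negP => /kmin; rewrite ltnn.
exists (vpick (lc k)); rewrite ?vpick0 //; split => [|x].
  apply: subvP (memv_pick _); apply: lower_central_sub; rewrite leqNgt.
  apply/negP => k2; apply: lc2; apply/eqP; rewrite -subv0 -lck.
  exact: lower_central_sub.
by apply/eqP; rewrite -memv0 -lck br_lower_central ?memv_pick.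
Qed.

Hypotheses (nd : nondegenerate_on g d) (np : ~ has_negative_pair g d).

(* A nilpotent skew operator is nilpotent on the Euclidean space e^perp / e,
   hence trivial there. *)
Lemma skew_bracket_line e x y : e != 0 -> e \in lc 2 -> (forall x, br x e = 0) ->
  y \in d -> g e y = 0 -> exists c, br x y = c *: e.
Proof.
move=> e0 lce ce; have de := lc2_derived lce.
have ee : g e e = 0 by apply: central_orth.
have step z : z \in d -> g e z = 0 -> br x z \in d /\ g e (br x z) = 0.
  move=> dz ez; split; first exact: br_derived.
  by rewrite -[LHS]opprK -skew // ce form0l oppr0.
have iterP m z : z \in d -> g e z = 0 ->
    iter m (br x) z \in d /\ g e (iter m (br x) z) = 0.
  by move=> dz ez; elim: m => //= m [dm em]; apply: step.
(* The power drops by one each time: for [u = (ad x)^(m+1) z], skewness gives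
   [<u, u> = - <(ad x)^m z, (ad x)^(m+2) z>]. This is zero once the last vector is a multiple of
   [e], so [u] lies on the line of [e]. *)
have descent m :
    (forall z, z \in d -> g e z = 0 -> exists c, iter m.+1 (br x) z = c *: e) ->
    forall z, z \in d -> g e z = 0 -> exists c, br x z = c *: e.
  elim: m => // m IHm Q; apply: IHm => z dz ez.
  have [[dm em] [dm1 em1]] := (iterP m z dz ez, iterP m.+1 z dz ez).
  apply: (isotropic_orth_line nd np de e0 ee dm1 em1).
  rewrite {1}iterS skew // -iterS; have [c /= ->] := Q z dz ez.
  by rewrite formZr formC em mulr0 oppr0.
have [k lck] := hnil; apply: (descent k) => z dz ez; exists 0; rewrite scale0r.
apply/eqP; rewrite -memv0 -lck; apply: subvP (lower_central_subS _ _) _ _.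
elim: k {lck} => [|k IHk]; rewrite iterS; last exact: br_lower_central.
by apply: br_lower_central; apply: memvf.
Qed.

(** A central [e] in [lc 2] is orthogonal to [lc 2], so [lc 3] lies on the central line of [e]. *)
Lemma lower_central4_eq0 : lc 2 <> 0%VS -> lc 4 = 0%VS.
Proof.
move=> lc2; have [e e0 [lce ce]] := lower_central_top lc2.
have de := lc2_derived lce.
have lc3 : {in lc 3, forall z, exists c, z = c *: e}.
  apply: lie_prod_ind => [x y _ lcy||c y z [a ->] [b ->]].
  - by apply: skew_bracket_line; rewrite ?lc2_derived ?central_orth.
  - by exists 0; rewrite scale0r.
  - by exists (c * a + b); rewrite scalerDl scalerA.
apply/eqP; rewrite -subv0; apply/subvP => z; rewrite memv0; move: z.
apply: lie_prod_ind => [x y _ /lc3[c ->]||c y z /eqP-> /eqP->].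
- by rewrite brZr ce scaler0.
- exact: eqxx.
- by rewrite scaler0 addr0.
Qed.

(** If [lc 3] were zero, [ad x] would square to zero on [d]. For [z] not orthogonal to [e], the
    vector [[x, z]] is then isotropic and orthogonal to [e], so it is [c *: e]; skewness gives
    [c * g e z = 0]. *)
Lemma lower_central3_neq0 : lc 2 <> 0%VS -> lc 3 <> 0%VS.
Proof.
move=> lc2 lc3; apply: (lc2); have [e e0 [lce ce]] := lower_central_top lc2.
have de := lc2_derived lce.
have [f df ef] := nondegenerate_pairing nd de e0.
have ee : g e e = 0 by apply: central_orth.
have sq0 x z : z \in d -> br x (br x z) = 0.
  by move=> dz; apply/eqP; rewrite -memv0 -lc3 !br_lower_central.
have kill x z : z \in d -> g e z != 0 -> br x z = 0.
  move=> dz ez; have dxz : br x z \in d by apply: br_derived.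
  have [||c xz] := isotropic_orth_line nd np de e0 ee dxz.
  - by rewrite -[LHS]opprK -skew // ce form0l oppr0.
  - by rewrite skew // sq0 // form0r oppr0.
  have := skew x dz dz; rewrite xz !formE (formC g z e) => h.
  have /eqP : c * g e z = 0 by lra.
  by rewrite mulf_eq0 (negPf ez) orbF => /eqP ->; rewrite scale0r.
apply/eqP; rewrite -subv0; apply/lie_prod_subvP => x z _ dz; rewrite memv0.
(* If [z] is orthogonal to [e], then [z + f] and [f] are not, and [kill] applies to both. *)
have [ez|/kill -> //] := eqVneq (g e z) 0.
have := kill x (z + f); rewrite !formE ez add0r memvD // brDr (kill x f) // addr0.
by move=> ->.
Qed.

End SkewBracket.

(** * Consequences of the geodesic orbit condition *)

Section GeodesicOrbitNilmanifold.
Variables (R : realType) (n : vectType R).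
Variables (br : {bilinear n -> n -> n}) (g : {symmetric n}) (h : {vspace 'End(n)}).
Hypotheses (hbr : is_lie_bracket br) (hnil : is_nilpotent br).
Hypothesis hg : nondegenerate_on g fullv.
Hypotheses (hh : is_isotropy_algebra br g h) (hGO : geodesic_orbit br g h).
Let d := derived_algebra br.
Hypothesis hd : nondegenerate_on g d.
Let v := orthov g d.
Implicit Types (x y z w t : n) (A : 'End(n)).

Let orth_vd y z : y \in v -> z \in d -> g y z = 0.
Proof. by move=> /mem_orthovP/[apply]. Qed.

Let orth_dv z y : z \in d -> y \in v -> g z y = 0.
Proof. by move=> dz vy; rewrite formC orth_vd. Qed.

Let isotropy_skew A : A \in h -> skew_adjoint g A.
Proof. by case: hh => _ _; apply. Qed.

Let isotropy_der A : A \in h -> is_derivation br A.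
Proof. by case: hh => _ + _; apply. Qed.

Lemma isotropy_derived A z : A \in h -> z \in d -> A z \in d.
Proof.
move=> hA; move: z; apply: lie_prod_ind => [x y _ _||c x y Ax Ay].
- by rewrite isotropy_der // memvD ?br_derived.
- by rewrite linear0 mem0v.
- by rewrite linearP memvD ?memvZ.
Qed.

Lemma isotropy_orthov A y : A \in h -> y \in v -> A y \in v.
Proof.
move=> hA vy; apply/mem_orthovP => z dz.
by rewrite isotropy_skew // orth_vd ?oppr0 // isotropy_derived.
Qed.

Lemma skew_diag A x : skew_adjoint g A -> g (A x) x = 0.
Proof. by move=> /(_ x x); rewrite (formC g x) => ?; lra. Qed.

(** Testing the condition at [T = y + z] on [T] itself leaves [k * g T T = 0], so [k = 0] for
    non-null [T]. *)
Lemma geodesic_vector y z : y \in v -> z \in d -> g y y + g z z != 0 ->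
  exists2 A, A \in h & forall t, g (br (y + z) t + A t) (y + z) = 0.
Proof.
move=> vy dz nn; have [A hA [k kP]] := hGO (y + z); exists A => // t.
have := kP (y + z).
rewrite (brxx hbr) add0r skew_diag; last exact: isotropy_skew.
rewrite !formE (orth_vd vy dz) (orth_dv dz vy) addr0 add0r => /esym/eqP.
by rewrite mulf_eq0 (negPf nn) orbF => /eqP k0; rewrite -!formE kP k0 mul0r.
Qed.

(** Serves to make [y + s *: z] non-null: if both [s = 1] and [s = 2] fail, then [a = b = 0]. *)
Lemma nonnull_scaling (a b : R) : (a != 0) || (b != 0) ->
  exists2 s, s != 0 & a + s ^+ 2 * b != 0.
Proof.
have [ab ab0|] := eqVneq (a + b) 0; last by exists 1; rewrite ?oner_eq0 // expr1n mul1r.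
exists 2; rewrite ?pnatr_eq0 //; apply: contraTneq ab0 => ab'.
have b0 : b = 0 by lra.
have a0 : a = 0 by lra.
by rewrite a0 b0 eqxx.
Qed.

Lemma bracket_orthov_diag y z : y \in v -> z \in d -> g (br y z) z = 0.
Proof.
(* The condition is tested on [z]. For null [z] its right-hand side vanishes for every [k];
   otherwise rescaling [z] makes [k = 0]. *)
move=> vy dz; have [zz|zz] := eqVneq (g z z) 0.
  have [A hA [k /(_ z)]] := hGO (y + z).
  have dA := isotropy_derived hA dz.
  rewrite !brE (brxx hbr) addr0 !formE zz (orth_vd vy dz).
  rewrite !(orth_dv _ vy) ?br_derived // skew_diag; last exact: isotropy_skew.
  by move=> ?; lra.
have [|s s0 ns] := @nonnull_scaling (g y y) (g z z); first by rewrite zz orbT.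
have [||A hA /(_ z)] := @geodesic_vector y (s *: z) vy; first exact: memvZ.
  by rewrite !formE mulrA -expr2.
have dA := isotropy_derived hA dz.
rewrite !brE (brxx hbr) scaler0 addr0 !formE !(orth_dv _ vy) ?br_derived //.
rewrite skew_diag; last exact: isotropy_skew.
by rewrite mulr0 !addr0 add0r => /eqP; rewrite mulf_eq0 (negPf s0) => /eqP.
Qed.

(** The [x] with [ad x] skew on [d] form a subalgebra; it contains [v] by polarization of
    [bracket_orthov_diag], and [v] generates [n]. *)
Lemma bracket_skew x : {in d &, forall z w, g (br x z) w = - g z (br x w)}.
Proof.
move: x; apply: (nilpotent_generation hbr hnil).
- move=> c x y Px Py z w dz dw.
  by rewrite !brE !formE Px // Py //; ring.
- move=> x y Px Py z w dz dw; rewrite !(br_jacobi hbr) !formE.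
  by rewrite Px ?Py ?Px ?Py ?br_derived //; ring.
- move=> x; have [y [z [vy dz ->]]] := orthov_decomp x hd.
  exists y, z; split=> // z' w' dz' dw'.
  have := bracket_orthov_diag vy (memvD dz' dw').
  rewrite !brE !formE !bracket_orthov_diag // (formC g (br y w')) => ?; lra.
Qed.

(* Averaging the geodesic condition over y + s z and y - s z separates its two
   components. *)
Lemma isotropy_realizes_bracket y z : y \in v -> z \in d -> g y y != 0 ->
  exists A, [/\ A \in h, A y = 0 & A z = br y z].
Proof.
move=> vy dz yy.
have [|s s0 ns] := @nonnull_scaling (g y y) (g z z); first by rewrite yy.
(* Testing on [d] determines [A z] independently of [r]; testing on [v] gives an [A y] linear in
   [r], which cancels between [s] and [- s]. *)
have half r : r ^+ 2 = s ^+ 2 -> r != 0 -> exists A, [/\ A \in h,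
    A z = - br y z & forall t, t \in v -> g t (A y) = r * g (br y t) z].
  move=> rs r0; have [||A hA AP] := @geodesic_vector y (r *: z) vy; first exact: memvZ.
    by rewrite !formE mulrA -expr2 rs.
  exists A; split=> // [|t vt].
    apply/eqP; rewrite -addr_eq0; apply/eqP/hd => [|w dw].
      by rewrite memvD ?isotropy_derived ?br_derived.
    have := AP w; have dA := isotropy_derived hA dw.
    rewrite !brE !formE !(orth_dv _ vy) ?br_derived //.
    rewrite (formC g (A w)) -[g z (A w)]opprK -isotropy_skew //.
    rewrite (formC g (br y w)) -[g z (br y w)]opprK -bracket_skew //.
    rewrite (formC g (br z w)) -[g z (br z w)]opprK -bracket_skew // (brxx hbr) form0l.
    rewrite oppr0 !mulr0 !addr0 !add0r -mulrDr => /eqP.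
    by rewrite mulf_eq0 (negPf r0) /= => /eqP ?; lra.
  have := AP t; have vA := isotropy_orthov hA vt.
  have zt : g (br z t) z = 0.
    by rewrite (brC hbr) formNl bracket_orthov_diag ?oppr0.
  rewrite !brE !formE !(orth_dv (br_derived br _ _) vy) zt (orth_vd vA dz).
  rewrite isotropy_skew // => ?; lra.
have [A [hA Az Ay]] := half s erefl s0.
have [||B [hB Bz By]] := half (- s); rewrite ?sqrrN ?oppr_eq0 //.
(* The factor is the average, with the sign that turns [- br y z] into [br y z]. *)
exists (- 2^-1 *: (A + B)); split; first by rewrite memvZ ?memvD.
  apply: hg (memvf _) _ => x _.
  have [t [w [vt dw ->]]] := orthov_decomp x hd.
  rewrite !lfunE /= !lfunE /= !formE !(orth_vd _ dw) ?isotropy_orthov //.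
  by rewrite (formC g (A y)) (formC g (B y)) Ay // By //; ring.
rewrite !lfunE /= !lfunE /= Az Bz -opprD scalerN scaleNr opprK.
by rewrite -mulr2n -scaler_nat scalerA mulVf ?scale1r // pnatr_eq0.
Qed.

(** For [A] with [A y = 0] and [A z = w], the form [<w, [., .]>] is [- act f] with [f = <z,
    [., .]>]. Since [w] is central, [A w = 0], so [act (act f) = 0], and semisimplicity on [U] gives
    [act f = 0]. *)
Lemma central_bracket_eq0 y z : y \in v -> g y y != 0 ->
  positive_definite_on g (v :&: orthov g <[y]>) ->
  z \in d -> (forall x, br x (br y z) = 0) -> br y z = 0.
Proof.
move=> vy yy; set U := (v :&: _)%VS => posU dz wc.
have [A [hA Ay Az]] := isotropy_realizes_bracket vy dz yy.
have Ader := isotropy_der hA; have Ask := isotropy_skew hA.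
move: wc Az; set w := br y z => wc Az.
have dw : w \in d by apply: br_derived.
have Aw : A w = 0 by rewrite /w Ader Ay (br0l br) add0r Az wc.
have UP t : (t \in U) = (t \in v) && (g t y == 0) by rewrite memv_cap mem_orthov1.
have AU : {in U, forall t, A t \in U}.
  move=> t; rewrite !UP => /andP[vt _].
  by rewrite isotropy_orthov //= Ask Ay form0r oppr0.
have transfer x t u : g (A x) (br t u) = - (g x (br (A t) u) + g x (br t (A u))).
  by rewrite Ask Ader formDr.
have [s sU sP] := parseval_frame posU.
have wU : {in U &, forall t u, g w (br t u) = 0}.
  move=> t u Ut Uu; rewrite -Az transfer; apply/eqP; rewrite oppr_eq0; apply/eqP.
  apply: (skew_biscalar_ker2 sU sP AU Ask (f := fun t u => g z (br t u))) Ut Uu.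
  - by move=> x c a b; rewrite !(brE, formE).
  - by move=> x c a b; rewrite !(brE, formE).
  move=> a b _ _ /=; have := transfer w a b.
  by rewrite Aw form0l -Az !transfer => ?; lra.
(* Since [A y = 0], the form with first argument [y] reduces to a linear form in [t]. *)
have wy : {in U, forall t, g w (br y t) = 0}.
  move=> t Ut; rewrite -Az transfer Ay (br0l br) form0r add0r.
  apply/eqP; rewrite oppr_eq0; apply/eqP.
  apply: (skew_scalar_ker2 sU sP AU Ask (a := fun t => g z (br y t))) Ut.
    by move=> c a b; rewrite !(brE, formE).
  move=> a _ /=; have := transfer w y a.
  by rewrite Aw form0l -Az !transfer Ay linear0 !(br0l br) !form0r => ?; lra.
have vdec t : t \in v -> exists c u, u \in U /\ t = c *: y + u.
  move=> vt; exists (g t y / g y y), (t - (g t y / g y y) *: y).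
  split; last by rewrite addrC subrK.
  by rewrite UP memvB ?memvZ //= !formE divfK ?subrr.
have wv t u : t \in v -> u \in v -> g w (br t u) = 0.
  move=> /vdec[c [t' [Ut ->]]] /vdec[b [u' [Uu ->]]].
  rewrite !brE (brxx hbr) !formE form0r (brC hbr t' y) formNr.
  by rewrite !wy // wU //; ring.
apply: hd => // t; move: t; apply: lie_prod_ind => [a b _ _||c a b wa wb]; last first.
- by rewrite !formE wa wb mulr0 addr0.
- by rewrite form0r.
(* Skewness makes the central [w] orthogonal to [[n, d]]; the rest of [d] comes from [[v, v]]. *)
have wd x t : t \in d -> g w (br x t) = 0.
  by move=> dt; rewrite -[LHS]opprK -bracket_skew // wc form0l oppr0.
have [a1 [a2 [va da ->]]] := orthov_decomp a hd.
have [b1 [b2 [vb db ->]]] := orthov_decomp b hd.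
by rewrite !brDl !brDr (brC hbr a2 b1) !formE wv // !wd //; ring.
Qed.

Lemma positive_definite_nonneg (U : {vspace n}) : {in U, forall x, 0 <= g x x} ->
  nondegenerate_on g U -> positive_definite_on g U.
Proof.
move=> U0 nd x Ux; rewrite lt0r U0 // andbT; apply: contraNN => /eqP xx.
by apply/eqP/nd => // y Uy; apply: (semidefinite_isotropic U0 Ux Uy xx).
Qed.

(** For negative [y], its orthogonal in [v] is positive definite, and [central_bracket_eq0] applies.
    If a negative [x] exists, so is [x + c *: y] for small [c], and linearity reaches every [y];
    otherwise [v] is Euclidean. *)
Lemma bracket_orthov_eq0 y z : ~ has_negative_pair g v -> y \in v ->
  z \in d -> (forall x x', br x (br x' z) = 0) -> br y z = 0.
Proof.
move=> npv vy dz zc; have ndv := nondegenerate_on_orthov hg hd.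
have neg0 x : x \in v -> g x x < 0 -> br x z = 0.
  move=> vx xx; apply: central_bracket_eq0 => //; first by rewrite lt_eqF.
  have UP t : (t \in v :&: orthov g <[x]>)%VS = (t \in v) && (g t x == 0).
    by rewrite memv_cap mem_orthov1.
  apply: positive_definite_nonneg => [t|t]; rewrite UP => /andP[vt /eqP tx].
    by rewrite leNgt; apply/negP => tt; apply: npv; exists t, x.
  move=> tP; apply: ndv => // u vu.
  pose p := u - (g u x / g x x) *: x.
  have px : g p x = 0 by rewrite /p !formE divfK ?subrr // lt_eqF.
  have := tP p; rewrite UP px eqxx memvB ?memvZ // /p !formE tx mulr0 subr0.
  exact.
have [[x vx xx]|noneg] := EM (exists2 x, x \in v & g x x < 0).
  (* For [0 < c <= 1], the square of [x + c *: y] is at most [- a + c * b]; the chosen [c] satisfies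
     [c * b < a]. *)
  pose a := - g x x; pose b := `|2 * g x y| + `|g y y|.
  have a0 : 0 < a by rewrite oppr_gt0.
  have b0 : 0 <= b by rewrite addr_ge0.
  pose c := a / (a + b + 1); have c0 : 0 < c by rewrite divr_gt0 //; lra.
  have c1 : c <= 1 by rewrite ler_pdivrMr; lra.
  have : br (x + c *: y) z = 0.
    apply: neg0; first by rewrite memvD ?memvZ.
    have -> : g (x + c *: y) (x + c *: y) = - a + c * (2 * g x y + c * g y y).
      by rewrite !formE (formC g y x) /a; ring.
    have le_b : 2 * g x y + c * g y y <= b.
      rewrite lerD ?ler_norm // (le_trans (ler_norm _)) // normrM (gtr0_norm c0).
      by rewrite ler_piMl.
    have cb : c * b < a.
      by rewrite /c mulrAC ltr_pdivrMr; [nra|lra].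
    have := ler_wpM2l (ltW c0) le_b; lra.
  rewrite !brE neg0 // add0r => /eqP; rewrite scaler_eq0 gt_eqF //=.
  by move/eqP.
have posv : positive_definite_on g v.
  apply: positive_definite_nonneg => // x vx; rewrite leNgt; apply/negP => xx.
  by apply: noneg; exists x.
have [->|y0] := eqVneq y 0; first exact: br0l.
apply: central_bracket_eq0 => //; first by rewrite gt_eqF ?posv.
by move=> x /memv_capP[vx _]; apply: posv.
Qed.

(** Descending induction: if [lower_central br k.+2] is central, [v] annihilates
    [lower_central br k.+1], and so does [n], which [v] generates. The last term reached is [d]. *)
Lemma lower_central2_eq0 : ~ has_negative_pair g v -> lower_central br 2 = 0%VS.
Proof.
move=> npv.
have down k : (forall x, {in lower_central br k.+2, forall z, br x z = 0}) ->
    forall x, {in lower_central br k.+1, forall z, br x z = 0}.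
  move=> ck x z zk; have dz : z \in d := subvP (lower_central_sub br (ltn0Sn k)) z zk.
  have zv y : y \in v -> br y z = 0.
    by move=> vy; apply: bracket_orthov_eq0 => // a b; apply/ck/br_lower_central.
  move: x; apply: (nilpotent_generation hbr hnil) => [c x y||].
  - by rewrite !brE => -> ->; rewrite scaler0 addr0.
  - by move=> x y xz yz; rewrite (br_jacobi hbr) xz yz !br0r subrr.
  move=> x; have [y [t [vy dt ->]]] := orthov_decomp x hd.
  by exists y, t; split; rewrite ?zv.
have central k : (forall x, {in lower_central br k.+1, forall z, br x z = 0}) ->
    forall x, {in d, forall z, br x z = 0}.
  by elim: k => // k IHk /down.
have [k lck] := hnil; have {}central := central k.
apply/eqP; rewrite -subv0; apply/lie_prod_subvP => x z _ dz; rewrite central ?mem0v //.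
move=> t w /(subvP (lower_central_subS br k)); rewrite lck memv0 => /eqP ->.
exact: br0r.
Qed.

End GeodesicOrbitNilmanifold.

(** * The index bound and the final case distinction *)

Lemma no_two_negative_pairs (R : realType) (n : vectType R) (g : {symmetric n})
    (U : {vspace n}) :
  has_index g 3 -> has_negative_pair g U -> ~ has_negative_pair g (orthov g U).
Proof.
move=> idx [u1 [u2 [Uu1 Uu2 n1 n2 u12]]] [v1 [v2 [Vv1 Vv2 m1 m2 v12]]].
have o u v : u \in U -> v \in orthov g U -> g u v = 0 /\ g v u = 0.
  by move=> Uu /mem_orthovP /(_ u Uu) vu; rewrite formC.
have [[o11 p11] [o12 p12]] := (o _ _ Uu1 Vv1, o _ _ Uu1 Vv2).
have [[o21 p21] [o22 p22]] := (o _ _ Uu2 Vv1, o _ _ Uu2 Vv2).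
have u21 : g u2 u1 = 0 by rewrite formC.
have v21 : g v2 v1 = 0 by rewrite formC.
suff : (4 <= 3)%N by [].
(* Two negative pairs in orthogonal subspaces give four pairwise orthogonal negative vectors, more
   than the index. *)
apply: (index_bound (x := fun i : 'I_4 => nth 0 [:: u1; u2; v1; v2] i) idx).
  by case=> [[|[|[|[|]]]]].
by case=> [[|[|[|[|//]]]] ?] [[|[|[|[|//]]]] ?].
Qed.

Theorem theorem1 (R : realType) (n : vectType R)
    (br : {bilinear n -> n -> n}) (g : {symmetric n}) (h : {vspace 'End(n)})
    (hbr : is_lie_bracket br) (hnil : is_nilpotent br)
    (hg : nondegenerate_on g fullv) (hindex : has_index g 3%N)
    (hh : is_isotropy_algebra br g h)
    (hGO : geodesic_orbit br g h)
    (hd : nondegenerate_on g (derived_algebra br)) :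
  is_abelian br \/ step_nilpotent br 2%N \/ step_nilpotent br 4%N.
Proof.
have [lc2|/eqP lc2] := eqVneq (lower_central br 2) 0%VS.
  have [lc1|/eqP lc1] := eqVneq (lower_central br 1) 0%VS; [left|right; left].
    by move=> x y; apply/eqP; rewrite -memv0 -lc1 br_lower_central ?memvf.
  exact: step_nilpotentP.
right; right; have skew := bracket_skew hbr hnil hh hGO hd.
have [npd|npd] := EM (has_negative_pair g (derived_algebra br)).
  case: lc2; apply: (lower_central2_eq0 hbr hnil hg hh hGO hd).
  exact: no_two_negative_pairs.
apply: step_nilpotentP.
  exact: (lower_central4_eq0 hnil skew hd npd).
exact: (lower_central3_neq0 hnil skew hd npd).
Qed.
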